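(* Let $\phi,\psi$ be injective endomorphisms of $F_n$. Then the action of $\mathrm{Eq}(\phi,\psi)$ on the set of regular points of $\mathrm{Eq}(\widehat\phi,\widehat\psi)$, by left multiplication, has finitely many orbits.
   Context: $F_n$ is the free group on a finite basis $A$; elements are identified with reduced words over $\widetilde A=A\cup A^{-1}$; maps are written on the right. For reduced words $u,v$, $u\wedge v$ is their longest common prefix. $\widehat F_n$ is the completion of $F_n$ for the prefix metric $d(u,v)=2^{-|u\wedge v|}$ ($u\neq v$), $d(u,u)=0$; it is the set of all finite and infinite reduced words over $\widetilde A$. An injective endomorphism $\phi$ of $F_n$ has a unique continuous extension $\widehat\phi$ to $\widehat F_n$. $\mathrm{Eq}(\phi,\psi)=\{x\in F_n\mid x\phi=x\psi\}$ (a subgroup) and $\mathrm{Eq}(\widehat\phi,\widehat\psi)=\{x\in\widehat F_n\mid x\widehat\phi=x\widehat\psi\}$. The subgroup $\mathrm{Eq}(\phi,\psi)$ acts on $\mathrm{Eq}(\widehat\phi,\widehat\psi)$ by left multiplication $u\cdot\alpha=$ reduced form of $u\alpha$. A point of $\mathrm{Eq}(\widehat\phi,\widehat\psi)$ is singular if it lies in the topological closure of $\mathrm{Eq}(\phi,\psi)$ in $\widehat F_n$, and regular otherwise. *)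

(* Defs.v *)
From mathcomp Require Import all_boot.
Set Implicit Arguments. Unset Strict Implicit. Unset Printing Implicit Defensive.

(* Letters of \tilde A = A ∪ A^{-1}: (a, false) is a, (a, true) is a^{-1}. *)
Definition letter (n : nat) := ('I_n * bool)%type.
Definition linv n (x : letter n) : letter n := (x.1, ~~ x.2).

Fixpoint reducedw n (s : seq (letter n)) : bool :=
  match s with
  | x :: ((y :: _) as t) => (y != linv x) && reducedw t
  | _ => true
  end.

Fixpoint reduce n (s : seq (letter n)) : seq (letter n) :=
  match s with
  | [::] => [::]
  | x :: s' =>
      match reduce s' with
      | y :: r => if y == linv x then r else x :: y :: r
      | [::] => [:: x]
      end
  end.

Definition winv n (w : seq (letter n)) := rev (map (@linv n) w).

Inductive hw (n : nat) : Type :=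
| Fin of seq (letter n)
| Inf of (nat -> letter n).
Arguments Fin {n}. Arguments Inf {n}.

Definition hreduced n (x : hw n) : Prop :=
  match x with
  | Fin w => reducedw w
  | Inf f => forall i, f i.+1 <> linv (f i)
  end.

Definition hat n (x : hw n) (i : nat) : option (letter n) :=
  match x with
  | Fin w => onth w i
  | Inf f => Some (f i)
  end.

(* x and y have a common prefix of length >= m, i.e. d(x,y) <= 2^{-m}. *)
Definition agree n (m : nat) (x y : hw n) : Prop :=
  forall i, i < m -> hat x i = hat y i.

Definition heq n (x y : hw n) : Prop := forall i, hat x i = hat y i.

(* Left multiplication u·alpha = reduced form of u alpha (u reduced finite). *)
Definition hmul n (u : seq (letter n)) (x : hw n) : hw n :=
  match x with
  | Fin w => Fin (reduce (u ++ w))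
  | Inf f =>
      let k := find (fun i => f i != linv (nth (f 0) u (size u - i.+1)))
                    (iota 0 (size u)) in
      Inf (fun j => if j < size u - k then nth (f 0) u j
                    else f (j - (size u - k) + k))
  end.

(* An endomorphism of F_n, given by the images of the basis elements. *)
Definition endo (n : nat) := 'I_n -> seq (letter n).
Definition limg n (g : endo n) (x : letter n) : seq (letter n) :=
  if x.2 then winv (g x.1) else g x.1.
Definition eapply n (g : endo n) (w : seq (letter n)) : seq (letter n) :=
  reduce (flatten (map (limg g) w)).

Definition endo_injective n (g : endo n) : Prop :=
  forall u v, reducedw u -> reducedw v -> eapply g u = eapply g v -> u = v.

Definition cont_ext n (g : endo n) (Phi : hw n -> hw n) : Prop :=
  (forall u, reducedw u -> Phi (Fin u) = Fin (eapply g u)) /\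
  (forall x, hreduced x -> hreduced (Phi x)) /\
  (forall x, hreduced x -> forall k, exists m, forall y, hreduced y ->
       agree m x y -> agree k (Phi x) (Phi y)).

Definition Eqf n (g h : endo n) (u : seq (letter n)) : Prop :=
  reducedw u /\ eapply g u = eapply h u.

Definition Eqh n (Phi Psi : hw n -> hw n) (x : hw n) : Prop :=
  hreduced x /\ heq (Phi x) (Psi x).

Definition singular n (g h : endo n) (x : hw n) : Prop :=
  forall m, exists u, Eqf g h u /\ agree m (Fin u) x.

Definition regular n (g h : endo n) (Phi Psi : hw n -> hw n) (x : hw n) : Prop :=
  Eqh Phi Psi x /\ ~ singular g h x.

(* Main.v *)
Require Import Defs.
From mathcomp Require Import all_boot zify.
From Stdlib Require Import Classical.

(* Put q(u) = (u phi)^-1 (u psi); then q(u) = q(v) iff u and v lie in the same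
   right coset of Eq(phi, psi). Let u_k be the prefix of length k of an infinite
   alpha with alpha phi^ = alpha psi^. If q took some value infinitely often on
   the u_k, alpha would be a limit of elements u_k u_j^-1 of Eq(phi, psi); hence
   |q(u_k)| -> oo when alpha is regular. By bounded cancellation both u_k phi and
   u_k psi are prefixes of alpha phi^ up to C letters, so if |q(u_k)| is large, one
   of the two is well ahead of the other, and remains so as long as |q| stays large.
   If u psi is ahead and alpha = u beta, then beta phi^ agrees with q(u) except
   for the last C letters of q(u), and bounded cancellation for phi shows that
   q(u) determines the next letter of alpha. Therefore, if u is the last prefix
   with |q(u)| <= N, the orbit of alpha is determined by q(u), the next letter
   and the side which is ahead: finitely many data. *)

Set Implicit Arguments. Unset Strict Implicit. Unset Printing Implicit Defensive.

(** * Reduction in the free group *)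

Section Words.
Variable n : nat.
Implicit Types (x y : letter n) (u v w : seq (letter n)).

Lemma linvK : involutive (@linv n).
Proof. by case=> a b; rewrite /linv /= negbK. Qed.

Definition compat x y := y != linv x.

Lemma reducedwE w : reducedw w = sorted compat w.
Proof. by elim: w => [|x [|y t] IH] //=; rewrite [LHS]/= in IH *; rewrite IH. Qed.

Lemma compat_linv x y : compat (linv y) (linv x) = compat x y.
Proof.
by rewrite /compat (inj_eq (inv_inj linvK)) -[y in RHS]linvK (inj_eq (inv_inj linvK)) eq_sym.
Qed.

Lemma reducedw_catl u v : reducedw (u ++ v) -> reducedw u.
Proof. by rewrite !reducedwE => /cat_sorted2[]. Qed.

Lemma reducedw_catr u v : reducedw (u ++ v) -> reducedw v.
Proof. by rewrite !reducedwE => /cat_sorted2[]. Qed.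

Lemma reducedw_cat u x v :
  reducedw (rcons u x) -> reducedw (x :: v) -> reducedw (rcons u x ++ v).
Proof.
rewrite !reducedwE cat_rcons; case: u => [|y u] //=.
by rewrite rcons_path cat_path /= => /andP[-> ->] ->.
Qed.

Lemma reducedw_winv u : reducedw (winv u) = reducedw u.
Proof.
rewrite !reducedwE /winv rev_sorted.
elim: u => //= x u; case: u => //= y u ->; congr (_ && _).
exact: compat_linv.
Qed.

Lemma size_winv u : size (winv u) = size u.
Proof. by rewrite size_rev size_map. Qed.

Lemma winvK : involutive (@winv n).
Proof. by move=> u; rewrite /winv map_rev revK mapK //; exact: linvK. Qed.

Lemma winv_cat u v : winv (u ++ v) = winv v ++ winv u.
Proof. by rewrite /winv map_cat rev_cat. Qed.

Lemma winv_cons x u : winv (x :: u) = rcons (winv u) (linv x).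
Proof. by rewrite /winv /= rev_cons. Qed.

Lemma winv_rcons u x : winv (rcons u x) = linv x :: winv u.
Proof. by rewrite /winv map_rcons rev_rcons. Qed.

(** One step of [reduce], isolated because on reduced words it is left multiplication by a letter,
    undone by the inverse letter ([push_linv]); associativity of the reduced product rests on
    this. *)
Definition push x u :=
  if u is y :: r then if y == linv x then r else x :: u else [:: x].

Lemma reduce_cons x u : reduce (x :: u) = push x (reduce u).
Proof. by rewrite /=; case: (reduce u). Qed.

Lemma push_reduced x u : reducedw u -> reducedw (push x u).
Proof.
case: u => [|y r] //= h; case: eqVneq => [_|ne]; last by rewrite /= ne.
by case: r h => // z r /andP[].
Qed.

Lemma reduce_reduced u : reducedw (reduce u).
Proof. by elim: u => // x u; rewrite reduce_cons; exact: push_reduced. Qed.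

Lemma reduce_id u : reducedw u -> reduce u = u.
Proof.
elim: u => // x [|y t] IH // h; rewrite reduce_cons IH; first last.
  by case/andP: h.
by rewrite /push; case/andP: h => /negbTE ->.
Qed.

Lemma push_linv x u : reducedw u -> push x (push (linv x) u) = u.
Proof.
case: u => [|y r] /=; first by rewrite eqxx.
rewrite linvK; case: eqVneq => [->|ne] h; last by rewrite /= eqxx.
case: r h => // z r /andP[/negbTE ne _] /=.
by rewrite ne.
Qed.

Lemma reduce_catr u v : reduce (u ++ reduce v) = reduce (u ++ v).
Proof.
elim: u => [|x u IH]; first by rewrite reduce_id ?reduce_reduced.
by rewrite !cat_cons !reduce_cons IH.
Qed.

Lemma reduce_push x r v : reduce (push x r ++ v) = push x (reduce (r ++ v)).
Proof.
case: r => [|y r]; first exact: reduce_cons.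
rewrite [push x (y :: r)]/=; case: eqVneq => [->|ne]; last by rewrite -reduce_cons.
by rewrite cat_cons reduce_cons push_linv ?reduce_reduced.
Qed.

Lemma reduce_catl u v : reduce (reduce u ++ v) = reduce (u ++ v).
Proof.
elim: u => // x u IH.
by rewrite reduce_cons reduce_push IH cat_cons reduce_cons.
Qed.

Lemma reduce_cat3 u v w : reduce (u ++ reduce v ++ w) = reduce (u ++ v ++ w).
Proof. by rewrite -reduce_catr reduce_catl reduce_catr. Qed.

Lemma reduce_Vcat u : reduce (winv u ++ u) = [::].
Proof.
elim: u => // x u IH; rewrite winv_cons cat_rcons -reduce_catr !reduce_cons.
by rewrite -{2}[x]linvK push_linv ?reduce_reduced // reduce_catr.
Qed.

Lemma reduce_catV u : reduce (u ++ winv u) = [::].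
Proof. by rewrite -{1}[u]winvK reduce_Vcat. Qed.

Lemma reduce_Kcat u v w : reduce (u ++ winv v ++ v ++ w) = reduce (u ++ w).
Proof. by rewrite catA -catA (catA (winv v)) -reduce_cat3 reduce_Vcat. Qed.

Lemma reduce_KVcat u v w : reduce (u ++ v ++ winv v ++ w) = reduce (u ++ w).
Proof. by rewrite -{1}[v]winvK reduce_Kcat. Qed.

Lemma reduce_catKV u v : reduce ((u ++ v) ++ winv v) = reduce u.
Proof. by rewrite -catA -reduce_catr reduce_catV cats0. Qed.

Lemma reduce_VKcat u v : reduce (winv u ++ u ++ v) = reduce v.
Proof. exact: (reduce_Kcat [::]). Qed.

Lemma reduce_winv u : reduce (winv u) = winv (reduce u).
Proof.
rewrite -[RHS]reduce_id ?reducedw_winv ?reduce_reduced //.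
rewrite -[winv (reduce u)]cats0 -(reduce_KVcat _ u [::]) cats0 catA.
by rewrite -reduce_catl -(reduce_catr (winv (reduce u))) reduce_Vcat.
Qed.

Lemma size_reduce u : size (reduce u) <= size u.
Proof.
elim: u => // x u IH; rewrite reduce_cons; apply: leq_trans (_ : (size (reduce u)).+1 <= _) => //.
by case: (reduce u) => //= y r; case: ifP => //=; lia.
Qed.

(** * Branching and longest common prefixes *)

Lemma reducedw_branch x y u v :
  reducedw (x :: u) -> reducedw (y :: v) -> x != y ->
  reducedw (winv (x :: u) ++ y :: v).
Proof.
rewrite -(reducedw_winv (x :: u)) winv_cons => hu hv ne; apply: reducedw_cat => //.
by move: hv; rewrite !reducedwE /= /compat linvK eq_sym ne.
Qed.

Lemma branch_irreducible x u v : reducedw (winv (x :: u) ++ x :: v) = false.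
Proof.
apply/negbTE/negP; rewrite winv_cons cat_rcons => /reducedw_catr.
by rewrite reducedwE /= /compat linvK eqxx.
Qed.

(** Reducedness of [winv s ++ t] encodes that [s] and [t] do not share a first letter, so [p] is the
    longest common prefix; in this form [reduce_lcp] reads off the reduced product of the inverse of
    [u] with [v]. *)
Lemma lcp u v : reducedw u -> reducedw v ->
  exists p s t, [/\ u = p ++ s, v = p ++ t & reducedw (winv s ++ t)].
Proof.
elim: u v => [|x u IH] [|y v] hu hv.
- by exists [::], [::], [::].
- by exists [::], [::], (y :: v).
- by exists [::], (x :: u), [::]; split; rewrite // cats0 reducedw_winv.
have [exy|ne] := eqVneq x y; last first.
  by exists [::], (x :: u), (y :: v); split => //; apply: reducedw_branch.
have [|| p [s [t [-> -> h]]]] := IH v.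
- exact: (@reducedw_catr [:: x]).
- exact: (@reducedw_catr [:: y]).
by exists (x :: p), s, t; rewrite exy.
Qed.

Lemma reduce_lcp (p s t : seq (letter n)) : reducedw (winv s ++ t) ->
  reduce (winv (p ++ s) ++ p ++ t) = winv s ++ t.
Proof. by move=> h; rewrite winv_cat -catA reduce_Kcat reduce_id. Qed.

(** What cancels is the longest common prefix of [winv u] and [reduce v], of length at most
    [size v]. *)
Lemma prefix_reduce_cat u v : reducedw u ->
  prefix (take (size u - size v) u) (reduce (u ++ v)).
Proof.
move=> hu; have := lcp (u := winv u) (v := reduce v).
rewrite reducedw_winv reduce_reduced => /(_ hu isT)[p [s [t [e1 e2 h]]]].
have := reduce_lcp p h; rewrite -e1 -e2 winvK reduce_catr => ->.
have eu : u = winv s ++ winv p by rewrite -winv_cat -e1 winvK.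
apply: prefix_trans (prefix_prefix _ _).
have := size_reduce v; rewrite e2 eu !size_cat !size_winv => hs.
by rewrite takel_cat ?prefix_take // size_winv; lia.
Qed.

End Words.

(** * Uniform bounds and representatives over a finite type *)

Section FiniteBounds.

Lemma fin_bound (I : finType) (A : I -> nat -> Prop) :
  (forall i, exists M, forall m, A i m -> m <= M) ->
  exists M, forall i m, A i m -> m <= M.
Proof.
case/fin_all_exists => F hF; exists (\max_i F i) => i m /hF hm.
exact: leq_trans hm (leq_bigmax i).
Qed.

(** One point is chosen classically for each code that is attained. [code] is a relation because the
    code of an infinite word is only known to exist. *)
Lemma finite_representatives (I : finType) (X : Type) (P : X -> Prop)
    (code : X -> I -> Prop) :
  (forall x, P x -> exists c, code x c) ->
  exists k (rep : 'I_k -> X), (forall i, P (rep i)) /\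
    forall x, P x -> exists i c, code (rep i) c /\ code x c.
Proof.
move=> total.
suff [k [rep [hP hrep]]] : exists k (rep : 'I_k -> X), (forall i, P (rep i)) /\
    forall x c, c \in enum I -> P x -> code x c -> exists i, code (rep i) c.
  exists k, rep; split=> // x Px; have [c hc] := total x Px.
  by have [|||i hi] := hrep x c; rewrite ?mem_enum //; exists i, c.
elim: (enum I) => [|c s [k [rep [hP hrep]]]].
  have rep : 'I_0 -> X by case.
  by exists 0, rep; split=> [[]|].
have [[x0 [Px0 hx0]]|no] := classic (exists x, P x /\ code x c).
- exists k.+1, (fun i => if unlift ord0 i is Some j then rep j else x0); split.
    by move=> i; case: unliftP.
  move=> x d; rewrite inE => /orP[/eqP -> _ _|hd Px hx].
    by exists ord0; rewrite unlift_none.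
  by have [i hi] := hrep x d hd Px hx; exists (lift ord0 i); rewrite liftK.
- exists k, rep; split=> // x d; rewrite inE => /orP[/eqP -> Px hx|]; last exact: hrep.
  by case: no; exists x.
Qed.

End FiniteBounds.

(** * Bounded cancellation *)

Section Endomorphism.
Variables (n : nat) (g : endo n).
Implicit Types (u v w p : seq (letter n)).

Lemma eapply_cat u v : eapply g (u ++ v) = reduce (eapply g u ++ eapply g v).
Proof. by rewrite /eapply map_cat flatten_cat reduce_catl reduce_catr. Qed.

Lemma eapply_reduced u : reducedw (eapply g u).
Proof. exact: reduce_reduced. Qed.

Lemma eapply_winv u : eapply g (winv u) = winv (eapply g u).
Proof.
rewrite /eapply -reduce_winv; congr reduce.
elim: u => // x u IH.
rewrite winv_cons map_rcons flatten_rcons IH /= winv_cat; congr (_ ++ _).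
by case: x => i b; rewrite /limg /=; case: b; rewrite //= winvK.
Qed.

Lemma eapply_reduce u : eapply g (reduce u) = eapply g u.
Proof.
elim: u => // x u IH; rewrite reduce_cons -[x :: u]cat1s eapply_cat -IH -eapply_cat cat1s.
case: (reduce u) => // y r /=; case: eqVneq => // ->.
rewrite -cat1s -[linv x :: r]cat1s eapply_cat [in RHS]eapply_cat reduce_catr.
have -> : [:: linv x] = winv [:: x] by [].
by rewrite eapply_winv -[eapply g [:: x]]cat0s -catA reduce_KVcat reduce_id ?eapply_reduced.
Qed.

Definition stretch := \max_(x : letter n) size (limg g x).

Lemma size_eapply u : size (eapply g u) <= stretch * size u.
Proof.
apply: leq_trans (size_reduce _) _; elim: u => // x u IH.
by rewrite /= size_cat mulnS leq_add // (leq_bigmax x).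
Qed.

(* The path through the images of the prefixes of [y] moves by at most [stretch]
   at each step, so it comes close to every point of the geodesic to its end. *)
Lemma near_image_prefix y p : prefix p (eapply g y) ->
  exists j, size (reduce (winv p ++ eapply g (take j y))) <= stretch.
Proof.
elim/last_ind: y p => [|y a IH] p hp.
  by exists 0; case: p hp.
have [hpy|npy] := boolP (prefix p (eapply g y)).
  have [j hj] := IH _ hpy; exists (minn j (size y)).
  by rewrite -cats1 takel_cat ?geq_minr // take_min take_size.
exists (size y).+1; rewrite -(size_rcons y a) take_size.
case/prefixP: hp => t et; rewrite et.
have redt : reducedw t by apply: (@reducedw_catr _ p); rewrite -et eapply_reduced.
(* If the rest [t] beyond [p] were longer than [stretch], stepping back by the image of [a] would
   not reach [p], which would then be a prefix of the image of [y]. *)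
rewrite reduce_VKcat reduce_id // leqNgt; apply: contra npy => lt.
have he : size (eapply g [:: a]) <= stretch.
  by apply: leq_trans (size_eapply _) _; rewrite muln1.
have -> : eapply g y = reduce (eapply g (rcons y a) ++ winv (eapply g [:: a])).
  rewrite -cats1 eapply_cat reduce_catl reduce_catKV.
  by rewrite reduce_id ?eapply_reduced.
apply: prefix_trans (prefix_reduce_cat _ (eapply_reduced _)).
rewrite size_winv et take_cat size_cat ltnNge.
have -> : size p <= size p + size t - size (eapply g [:: a]).
  by rewrite -addnBA ?leq_addr // (leq_trans he) // ltnW.
exact: prefix_prefix.
Qed.

Hypothesis inj : endo_injective g.

(** There are finitely many words of length at most [R], each with at most one reduced preimage. *)
Lemma eapply_proper R :
  exists M, forall w, reducedw w -> size (eapply g w) <= R -> size w <= M.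
Proof.
pose A (v : R.-bseq (letter n)) m :=
  exists w, [/\ reducedw w, eapply g w = v & size w = m].
have [v|M hM] := @fin_bound _ A.
  have [[w [hw ev]]|no] := classic (exists w, reducedw w /\ eapply g w = v).
    exists (size w) => m [w' [hw' ev' <-]].
    by rewrite (inj hw hw') // ev.
  by exists 0 => m [w [hw ev _]]; case: no; exists w.
exists M => w hw hs; apply: (hM (Bseq hs)); exists w; split => //.
Qed.

(* A prefix [p] common to both images is close to images of prefixes u', v' of
   [u] and [v], so the reduced word u'^-1 v' has a short image; by injectivity it
   is itself short, hence so is [p]. *)
Lemma bounded_cancellation : exists C, forall u v p, reducedw (winv u ++ v) ->
  prefix p (eapply g u) -> prefix p (eapply g v) -> size p <= C.
Proof.
have [M hM] := eapply_proper (stretch + stretch).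
exists (stretch + stretch * M) => u v p huv hpu hpv.
have [i hi] := near_image_prefix hpu; have [j hj] := near_image_prefix hpv.
have red : reducedw (winv (take i u) ++ take j v).
  move: huv; rewrite -{1}(cat_take_drop i u) -{1}(cat_take_drop j v) winv_cat -catA.
  by move/reducedw_catr; rewrite catA => /reducedw_catl.
have := hM _ red; rewrite eapply_cat eapply_winv.
have -> : reduce (winv (eapply g (take i u)) ++ eapply g (take j v)) =
    reduce (winv (reduce (winv p ++ eapply g (take i u))) ++
            reduce (winv p ++ eapply g (take j v))).
  by rewrite -reduce_winv reduce_catl reduce_catr winv_cat winvK -catA reduce_KVcat.
have h : size (take j v) <= size (winv (take i u) ++ take j v).
  by rewrite size_cat leq_addl.
move=> /(_ (leq_trans (size_reduce _) _)); rewrite size_cat size_winv leq_add // => /(_ isT) hs.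
have hv : size (eapply g (take j v)) <= stretch * M.
  by apply: leq_trans (size_eapply _) _; rewrite leq_mul2l (leq_trans h hs) orbT.
have -> : p = winv (reduce (reduce (winv p ++ eapply g (take j v)) ++ winv (eapply g (take j v)))).
  rewrite reduce_catl reduce_catKV reduce_id ?winvK // reducedw_winv.
  by case/prefixP: hpv => t et; apply: (@reducedw_catl _ _ t); rewrite -et eapply_reduced.
rewrite size_winv; apply: leq_trans (size_reduce _) _.
by rewrite size_cat size_winv leq_add.
Qed.

End Endomorphism.

(** * Left multiplication of infinite words *)

Section Streams.
Variable n : nat.
Implicit Types (f : nat -> letter n).

Lemma mkseqD f k j : mkseq f (k + j) = mkseq f k ++ mkseq (fun i => f (k + i)) j.
Proof. by rewrite /mkseq iotaD map_cat add0n -{2}[k]addn0 iotaDl -map_comp. Qed.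

Lemma reducedw_mkseq f k : hreduced (Inf f) -> reducedw (mkseq f k).
Proof.
move=> hf; rewrite reducedwE; case: k => // k; rewrite /mkseq /=.
elim: k 0 => //= k IH i; rewrite IH andbT; exact/eqP/hf.
Qed.

Lemma hreduced_shift f k : hreduced (Inf f) -> hreduced (Inf (fun i => f (k + i))).
Proof. by move=> hf i; rewrite /= addnS; exact: hf. Qed.

Lemma onth_mkseq f k i : i < k -> onth (mkseq f k) i = Some (f i).
Proof. by move=> hi; rewrite onthE (nth_map (f i)) ?size_mkseq // nth_mkseq. Qed.

(** The search in [hmul] stops exactly at [m]: the first [m] letters cancel, and the next
    comparison, if any, is between consecutive letters of the reduced word [f']. *)
Lemma heq_hmul_cat f f' m m' : hreduced (Inf f') ->
  (forall j, f (m + j) = f' (m' + j)) ->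
  heq (hmul (mkseq f' m' ++ winv (mkseq f m)) (Inf f)) (Inf f').
Proof.
move=> hf' tails i.
set W := _ ++ _; have sW : size W = m' + m.
  by rewrite size_cat size_winv !size_mkseq.
rewrite /hmul; set k := find _ _; have -> : k = m.
  rewrite /k sW addnC iotaD find_cat add0n.
  have -> : has (fun i => f i != linv (nth (f 0) W (m + m' - i.+1))) (iota 0 m) = false.
    apply/negbTE/hasPn => j; rewrite mem_iota add0n => /andP[_ hj].
    rewrite negbK nth_cat size_mkseq ifF; last by lia.
    rewrite nth_rev size_map size_mkseq; last by lia.
    rewrite (nth_map (f 0)) ?size_mkseq; last by lia.
    by rewrite linvK nth_mkseq; [apply/eqP; congr f|]; lia.
  rewrite size_iota; case E : m' => [|j] /=; first by rewrite addn0.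
  rewrite ifT ?addn0 // nth_cat size_mkseq E ifT; last by lia.
  rewrite nth_mkseq; last by lia.
  have -> : m + j.+1 - m.+1 = j by lia.
  by rewrite -{1}[m]addn0 tails E addn0; apply/eqP/hf'.
rewrite sW addnK /=; case: ltnP => hi; last by rewrite addnC tails subnKC.
by rewrite nth_cat size_mkseq hi nth_mkseq.
Qed.

(** When the two prefixes end in the same letter, it is moved into the common tail; once they do
    not, the product is already reduced. *)
Lemma heq_hmul f f' k k' : hreduced (Inf f) -> hreduced (Inf f') ->
  (forall j, f (k + j) = f' (k' + j)) ->
  heq (hmul (reduce (mkseq f' k' ++ winv (mkseq f k))) (Inf f)) (Inf f').
Proof.
move=> hf hf'; elim: k k' => [|k IH] [|k'] tails.
- by rewrite reduce_id //; apply: heq_hmul_cat.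
- by rewrite cats0 reduce_id ?reducedw_mkseq // -[mkseq f' _]cats0; apply: (@heq_hmul_cat _ _ 0).
- rewrite cat0s reduce_id ?reducedw_winv ?reducedw_mkseq //.
  exact: (@heq_hmul_cat _ _ _ 0).
have [e|ne] := eqVneq (f k) (f' k').
  rewrite !mkseqS winv_rcons cat_rcons -e.
  have -> : forall u, f k :: linv (f k) :: u = [:: f k] ++ winv [:: f k] ++ u by [].
  rewrite reduce_KVcat; apply: IH => -[|j]; first by rewrite !addn0.
  by rewrite -!addSnnS.
rewrite reduce_id; first exact: heq_hmul_cat.
rewrite !mkseqS winv_rcons; apply: reducedw_cat; rewrite -?mkseqS ?reducedw_mkseq //.
have := reducedw_mkseq k.+1 hf; rewrite -reducedw_winv mkseqS winv_rcons => h.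
by move: h; rewrite !reducedwE /= => ->; rewrite /compat (inj_eq (inv_inj (@linvK n))) ne.
Qed.

End Streams.

(** * Points with equal images *)

Section Pair.
Variables (n : nat) (C : nat).
Implicit Types (g h : endo n) (f : nat -> letter n) (u v w p : seq (letter n)).

Definition cancels g := forall u v p, reducedw (winv u ++ v) ->
  prefix p (eapply g u) -> prefix p (eapply g v) -> size p <= C.

(** What cancels between the images of [u] and [w] is a common prefix of the images of [winv u] and
    [w], hence has at most [C] letters. *)
Lemma cancels_prefix g u w : cancels g -> reducedw (u ++ w) ->
  prefix (take (size (eapply g u) - C) (eapply g u)) (eapply g (u ++ w)).
Proof.
move=> hC; rewrite -{1}[u]winvK => /hC hp.
have hu := eapply_reduced g (winv u); have hw := eapply_reduced g w.
have [p [s [t [eu ew red]]]] := lcp hu hw.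
have := hp p; rewrite eu ew !prefix_prefix => /(_ isT isT) sp.
have e : eapply g u = winv s ++ winv p.
  by rewrite -winv_cat -eu eapply_winv winvK.
rewrite eapply_cat -[eapply g u]winvK -eapply_winv eu ew reduce_lcp //.
rewrite winv_cat takel_cat; last by rewrite size_cat !size_winv; lia.
exact: prefix_trans (prefix_take _ _) (prefix_prefix _ _).
Qed.

(** This is q(u). The two maps are parameters because the argument is run in both orders, according
    to which image is ahead. *)
Definition defect g h u := reduce (winv (eapply g u) ++ eapply h u).

(** Hence the defect of a prefix and the next letter determine the next defect. *)
Lemma defect_cat g h u w :
  defect g h (u ++ w) = reduce (winv (eapply g w) ++ defect g h u ++ eapply h w).
Proof.
rewrite /defect !eapply_cat -reduce_winv reduce_catl reduce_catr winv_cat.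
by rewrite reduce_cat3 -!catA.
Qed.

Lemma defect_swap g h u : defect h g u = winv (defect g h u).
Proof. by rewrite /defect -reduce_winv winv_cat winvK. Qed.

Lemma defect_Eqf g h u v :
  defect g h u = defect g h v -> Eqf g h (reduce (u ++ winv v)).
Proof.
move=> e; split; first exact: reduce_reduced.
rewrite !eapply_reduce !eapply_cat !eapply_winv.
have ev : reduce (eapply g u ++ defect g h v ++ winv (eapply h v)) =
    reduce (eapply g u ++ winv (eapply g v)).
  by rewrite reduce_cat3 -reduce_catr reduce_catKV reduce_catr.
by rewrite -ev -e reduce_cat3 -catA (reduce_KVcat [::]).
Qed.

(** The trace on finite prefixes of the equality of the two infinite images; the combinatorial
    lemmas use it in place of the continuous extensions. *)
Definition follows g h f := forall k l,
  size (eapply h (mkseq f l)) <= size (eapply g (mkseq f k)) ->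
  prefix (take (size (eapply h (mkseq f l)) - C) (eapply h (mkseq f l)))
         (eapply g (mkseq f k)).

(* With u = u_k: as [u psi] is ahead, the common image extends [u psi] up to C
   letters, and cancelling [u phi] from it leaves q(u) up to C letters. *)
Lemma determined_segment g h f k : endo_injective g -> 
  hreduced (Inf f) -> follows g h f ->
  size (eapply g (mkseq f k)) <= size (eapply h (mkseq f k)) ->
  C + C < size (defect g h (mkseq f k)) ->
  exists j, prefix (take (size (defect g h (mkseq f k)) - C) (defect g h (mkseq f k)))
    (eapply g (mkseq (fun i => f (k + i)) j.+1)).
Proof.
move=> inj hf fol; set q := defect g h _ => ahead large.
have [M hM] := eapply_proper inj (size (eapply h (mkseq f k))).
pose j := maxn k M.
exists j; have longer : size (eapply h (mkseq f k)) <= size (eapply g (mkseq f (k + j.+1))).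
  rewrite leqNgt; apply/negP => /ltnW /hM; rewrite reducedw_mkseq // size_mkseq => /(_ isT).
  by rewrite /j; lia.
have /prefixP[r er] := fol _ _ longer.
have [p [s [t [eg eh red]]]] := lcp (eapply_reduced g (mkseq f k)) (eapply_reduced h (mkseq f k)).
have eq : q = winv s ++ t by rewrite /q /defect eg eh reduce_lcp.
move: ahead large er; rewrite eq eg eh !size_cat size_winv => ahead large.
(* Since [s] is no longer than [t], the [C] uncertain letters all lie in [t], and what is left of
   [t] is nonempty; the gluing of reduced words below needs this. *)
have tC : C < size t by lia.
rewrite -!addnBA; try lia.
rewrite !takeD !take_size_cat ?drop_size_cat ?size_winv // -catA => er.
have -> : eapply g (mkseq (fun i => f (k + i)) j.+1) = winv s ++ take (size t - C) t ++ r.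
  rewrite -[LHS]reduce_id ?eapply_reduced // -(reduce_VKcat (eapply g (mkseq f k))).
  rewrite -reduce_catr -eapply_cat -mkseqD er eg winv_cat -catA reduce_Kcat reduce_id //.
  have := eapply_reduced g (mkseq f (k + j.+1)); rewrite er => /reducedw_catr.
  move: red; rewrite -{1}(cat_take_drop (size t - C) t) catA => /reducedw_catl.
  case: (lastP (take _ _)) (size_takel (leq_subr C (size t))) => [|t1 x _]; first by move=> /=; lia.
  rewrite -rcons_cat => h1; rewrite cat_rcons => /reducedw_catr h2.
  by rewrite -cat_rcons catA -rcons_cat; apply: reducedw_cat.
by rewrite catA prefix_prefix.
Qed.

(** Tails with distinct first letters would branch at once, although their images share the first
    |q| - C > C letters of the common defect q, against bounded cancellation. *)
Lemma determined_letter g h f f' k k' :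
  endo_injective g -> cancels g ->
  hreduced (Inf f) -> hreduced (Inf f') -> follows g h f -> follows g h f' ->
  size (eapply g (mkseq f k)) <= size (eapply h (mkseq f k)) ->
  size (eapply g (mkseq f' k')) <= size (eapply h (mkseq f' k')) ->
  defect g h (mkseq f k) = defect g h (mkseq f' k') ->
  C + C < size (defect g h (mkseq f k)) ->
  f k = f' k'.
Proof.
move=> inj hC hf hf' fol fol' ahead ahead' e large.
have [j hj] := determined_segment inj hf fol ahead large.
have := determined_segment inj hf' fol' ahead'; rewrite -e => /(_ large)[j' hj'].
apply/eqP; apply: contraT => ne.
have [r r'] := (reducedw_mkseq j.+1 (hreduced_shift (k := k) hf), reducedw_mkseq j'.+1 (hreduced_shift (k := k') hf')).
have := hC _ _ _ _ hj hj'; rewrite size_takel ?leq_subr // => /(_ _).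
move: r r'; rewrite /mkseq /= !addn0 => r r' /(_ (reducedw_branch r r' ne)).
by rewrite leqNgt ltn_subRL large.
Qed.

(** Beyond the common prefix of the two images, that of [g] has at most [C] letters, so that of [h]
    has more than C + 2K; one more letter changes each length by at most [K]. *)
Lemma ahead_persists g h f k K :
  hreduced (Inf f) -> follows h g f -> stretch g <= K -> stretch h <= K ->
  size (eapply g (mkseq f k)) <= size (eapply h (mkseq f k)) ->
  C + C + K + K < size (defect g h (mkseq f k)) ->
  size (eapply g (mkseq f k.+1)) <= size (eapply h (mkseq f k.+1)).
Proof.
move=> hf fol gK hK ahead.
have /prefixP[r er] := fol _ _ ahead.
have [p [s [t [eg eh red]]]] := lcp (eapply_reduced g (mkseq f k)) (eapply_reduced h (mkseq f k)).
(* Otherwise [t] would begin with the first letter of [s], against the maximality of [p]. *)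
have sC : size s <= C.
  rewrite leqNgt; apply/negP => ltC; move: er; rewrite eg eh size_cat -addnBA; last exact: ltnW.
  rewrite takeD take_size_cat // drop_size_cat // -catA.
  move/eqP; rewrite eqseq_cat // eqxx /= => /eqP et.
  move: red; rewrite et; case: s ltC {eg et} => [|x s] // ltC.
  by rewrite subSn // /= branch_irreducible.
rewrite {1}/defect eg eh reduce_lcp // size_cat size_winv => large.
have [e1 e2] : size (eapply g [:: f k]) <= K /\ size (eapply h [:: f k]) <= K.
  by split; apply: leq_trans (size_eapply _ _) _; rewrite muln1.
have g1 : size (eapply g (mkseq f k.+1)) <= size p + size s + K.
  rewrite mkseqS -cats1 eapply_cat; apply: leq_trans (size_reduce _) _.
  by rewrite size_cat eg size_cat leq_add2l.
have h1 : size p + size t - K <= size (eapply h (mkseq f k.+1)).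
  rewrite mkseqS -cats1 eapply_cat -size_cat -eh.
  apply: leq_trans (size_prefix (prefix_reduce_cat _ (eapply_reduced _ _))).
  by rewrite size_takel ?leq_subr // leq_sub2l.
apply: leq_trans g1 (leq_trans _ h1); lia.
Qed.

(** Induction on [j], carrying equal letters, equal defects and the side that is ahead. The defect
    is known to be large only after [k], so the letter at [k] and the side at [k.+1] are given as
    data. *)
Lemma same_tail g h f f' k k' K :
  endo_injective g -> cancels g ->
  hreduced (Inf f) -> hreduced (Inf f') -> follows g h f -> follows g h f' ->
  follows h g f -> follows h g f' ->
  stretch g <= K -> stretch h <= K ->
  size (eapply g (mkseq f k.+1)) <= size (eapply h (mkseq f k.+1)) ->
  size (eapply g (mkseq f' k'.+1)) <= size (eapply h (mkseq f' k'.+1)) ->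
  defect g h (mkseq f k) = defect g h (mkseq f' k') -> f k = f' k' ->
  (forall l, k < l -> C + C + K + K < size (defect g h (mkseq f l))) ->
  forall j, f (k + j) = f' (k' + j).
Proof.
move=> inj hC hf hf' fol fol' folV folV' gK hK ahead ahead' e0 ef large j.
suff [] : [/\ f (k + j) = f' (k' + j),
    defect g h (mkseq f (k + j)) = defect g h (mkseq f' (k' + j)),
    size (eapply g (mkseq f (k + j).+1)) <= size (eapply h (mkseq f (k + j).+1)) &
    size (eapply g (mkseq f' (k' + j).+1)) <= size (eapply h (mkseq f' (k' + j).+1))] by [].
elim: j => [|j [ej dj aj aj']]; first by rewrite !addn0.
have d : defect g h (mkseq f (k + j).+1) = defect g h (mkseq f' (k' + j).+1).
  by rewrite !mkseqS -!cats1 !defect_cat ej dj.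
have L : C + C + K + K < size (defect g h (mkseq f (k + j).+1)) by apply: large; lia.
rewrite !addnS; split=> //.
- apply: (determined_letter inj hC hf hf' fol fol' aj aj' d); lia.
- exact: (ahead_persists hf folV gK hK aj L).
- by rewrite d in L; exact: (ahead_persists hf' folV' gK hK aj' L).
Qed.

(** By continuity the letter can be read in the image of a long finite prefix, where
    [cancels_prefix] protects it. *)
Lemma hat_image g G f k i : cancels g -> cont_ext g G -> hreduced (Inf f) ->
  i < size (eapply g (mkseq f k)) - C ->
  hat (G (Inf f)) i = onth (eapply g (mkseq f k)) i.
Proof.
move=> hC [fin [_ cont]] hf hi; have [m hm] := cont _ hf i.+1.
have red := reducedw_mkseq (k + m) hf.
rewrite (hm (Fin (mkseq f (k + m))) red _ i) //; last first.
  by move=> l hl; rewrite /= onth_mkseq //; lia.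
rewrite fin //=; move: red; rewrite mkseqD => /(cancels_prefix hC)/prefixP[r ->].
rewrite -[in RHS](cat_take_drop (size (eapply g (mkseq f k)) - C) (eapply g (mkseq f k))).
by rewrite !onth_cat size_takel ?leq_subr // hi.
Qed.

Lemma Eqh_follows g h G H f : cancels g -> cancels h ->
  cont_ext g G -> cont_ext h H -> Eqh G H (Inf f) -> follows g h f.
Proof.
move=> gC hC gG hH [hf e] k l le; set m := _ - C.
have {}le : m <= size (eapply g (mkseq f k)) - C by rewrite leq_sub2r.
rewrite prefixE size_takel ?leq_subr //; apply/eqP/(inj_map (@Some_inj _)).
have s1 : m <= size (eapply g (mkseq f k)) by apply: leq_trans le (leq_subr _ _).
have s2 : m <= size (eapply h (mkseq f l)) by apply: leq_subr.
apply: (@eq_from_nth _ None); rewrite !size_map !size_takel // => i hi.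
rewrite !map_take !nth_take // -!onthE.
by rewrite -(hat_image gC gG hf (leq_trans hi le)) -(hat_image hC hH hf hi).
Qed.

Lemma regular_defect_bound g h G H f N : regular g h G H (Inf f) ->
  exists M, forall k, size (defect g h (mkseq f k)) <= N -> k <= M.
Proof.
case=> [[hf _] nsing].
have [c|M hM] := @fin_bound (N.-bseq (letter n)) (fun c k => defect g h (mkseq f k) = c).
  apply: NNPP => unbounded; apply: nsing => m.
  have later M : exists2 k, M < k & defect g h (mkseq f k) = c.
    apply: NNPP => no; apply: unbounded; exists M => k ek; rewrite leqNgt.
    by apply/negP => lt; apply: no; exists k.
  (* Multiplying by the inverse of the prefix of length [j] removes at most [j] letters, so with
     [k > m + j] the first [m] letters of [f] survive. *)
  have [j _ ej] := later 0; have [k hk ek] := later (m + j).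
  exists (reduce (mkseq f k ++ winv (mkseq f j))); split.
    by apply: defect_Eqf; rewrite ek ej.
  have /prefixP[r er] := prefix_reduce_cat (winv (mkseq f j)) (reducedw_mkseq k hf).
  move=> i hi; rewrite /= er size_winv !size_mkseq.
  have -> : mkseq f k = mkseq f (k - j) ++ mkseq (fun i => f (k - j + i)) j.
    by rewrite -mkseqD subnK //; lia.
  rewrite take_size_cat ?size_mkseq // onth_cat size_mkseq.
  by rewrite ifT ?onth_mkseq //; lia.
by exists M => k hk; apply: (hM (Bseq hk)).
Qed.

End Pair.

(** * Finitely many orbits of regular points *)

Theorem theorem2p3 (n : nat) (phi psi : endo n)
  (Phi Psi : hw n -> hw n) :
  endo_injective phi -> endo_injective psi ->
  cont_ext phi Phi -> cont_ext psi Psi ->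
  exists (k : nat) (rep : 'I_k -> hw n),
    (forall i, regular phi psi Phi Psi (rep i)) /\
    forall x, regular phi psi Phi Psi x ->
      exists i u, Eqf phi psi u /\ heq (hmul u (rep i)) x.
Proof.
move=> injphi injpsi extphi extpsi.
have [C1 hC1] := bounded_cancellation injphi.
have [C2 hC2] := bounded_cancellation injpsi.
pose C := maxn C1 C2; pose K := maxn (stretch phi) (stretch psi).
have phiC : cancels C phi.
  by move=> u v p r pu pv; apply: leq_trans (hC1 u v p r pu pv) (leq_maxl _ _).
have psiC : cancels C psi.
  by move=> u v p r pu pv; apply: leq_trans (hC2 u v p r pu pv) (leq_maxr _ _).
have phiK : stretch phi <= K := leq_maxl _ _.
have psiK : stretch psi <= K := leq_maxr _ _.
(* The threshold of [ahead_persists]; it exceeds or equals the 2C of [determined_letter]. *)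
pose N := C + C + K + K.
pose ahead f k := size (eapply phi (mkseq f k)) <= size (eapply psi (mkseq f k)).
pose code (x : hw n) (c : N.-bseq (letter n) * letter n * bool) :=
  exists f k, [/\ x = Inf f, defect phi psi (mkseq f k) = c.1.1, f k = c.1.2,
    ahead f k.+1 = c.2 &
    forall l, k < l -> N < size (defect phi psi (mkseq f l))].
have [x reg|k [rep [hrep orbits]]] :=
    @finite_representatives _ _ (regular phi psi Phi Psi) code.
(* A finite point with equal images lies in Eq(phi, psi), hence is singular; only infinite words
   remain. *)
- case: x reg => [w [[/= hw e] nsing]|f reg].
    case: nsing => m; exists w; split=> //; split=> //.
    by apply: eq_from_onth => i; have := e i; rewrite (proj1 extphi) ?(proj1 extpsi).
  have [M hM] := regular_defect_bound N reg.
  pose P k := size (defect phi psi (mkseq f k)) <= N.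
  (* The empty prefix has empty defect, and regularity bounds the prefixes of small defect, so a
     last one exists. *)
  have P0 : exists k, P k by exists 0.
  case: (ex_maxnP P0 hM) => k Pk maxk.
  exists (Bseq Pk, f k, ahead f k.+1), f, k; split=> // l lt.
  by rewrite ltnNge; apply/negP => /maxk; rewrite leqNgt lt.
exists k, rep; split=> // x reg.
have [i [[[q a] b] [[f [j [ef qf af bf largef]]] [f' [j' [ef' qf' af' bf' largef']]]]]] :=
  orbits x reg.
move: qf qf' af af' bf bf' => /= qf qf' af af' bf bf'.
have [q_eq a_eq] : defect phi psi (mkseq f j) = defect phi psi (mkseq f' j') /\ f j = f' j'.
  by rewrite qf qf' af af'.
have regf := hrep i; move: reg regf; rewrite ef ef' => -[E' _] [E _].
have [hf hf'] : hreduced (Inf f) /\ hreduced (Inf f') by case: E E' => hf _ [].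
exists i, (reduce (mkseq f' j' ++ winv (mkseq f j))).
split; first by apply: defect_Eqf; rewrite q_eq.
rewrite ef; apply: heq_hmul => //.
have V F : Eqh Phi Psi (Inf F) -> Eqh Psi Phi (Inf F) by case=> hF e; split.
have fol := Eqh_follows phiC psiC extphi extpsi.
have folV := Eqh_follows psiC phiC extpsi extphi.
case: b bf bf' => /= bf bf'.
  by apply: (same_tail (g := phi) (h := psi) (C := C) (K := K)) => //;
    [exact: fol|exact: fol|exact/folV/V|exact/folV/V].
(* When psi is not ahead, phi is: the roles are exchanged, which inverts the defect and keeps its
   length. *)
have sym : forall F k, ahead F k = false ->
    size (eapply psi (mkseq F k)) <= size (eapply phi (mkseq F k)).
  by move=> F l /negbT; rewrite -ltnNge => /ltnW.
apply: (same_tail (g := psi) (h := phi) (C := C) (K := K)) => //;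
  rewrite ?[defect psi phi _]defect_swap ?q_eq //;
  [exact/folV/V|exact/folV/V|exact: fol|exact: fol|exact: sym|exact: sym|].
by move=> l lt; rewrite defect_swap size_winv; exact: largef.
Qed.
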